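(* Let $\mathcal{R}>0$, $\alpha>0$, $\beta>0$ be fixed, and let $\bar\gamma_{\mathrm{D}}>0$ with $\bar\gamma_{\mathrm{R}}=\alpha\bar\gamma_{\mathrm{D}}$ and $\bar\gamma_{\mathrm{E}}=\bar\gamma_{\mathrm{R}}/\beta$. Let $h_{\mathrm{S},\mathrm{R}},h_{\mathrm{R},\mathrm{D}},h_{\mathrm{S},\mathrm{E}}$ be independent $\mathcal{CN}(0,1)$ random variables, and define $$\mathcal{R}^{2}_{\mathrm{S}\to\mathrm{R}}=\log_2\frac{1+\bar\gamma_{\mathrm{R}}|h_{\mathrm{S},\mathrm{R}}|^2}{1+\bar\gamma_{\mathrm{E}}|h_{\mathrm{S},\mathrm{E}}|^2},\qquad \mathcal{R}^{2}_{\mathrm{R}\to\mathrm{D}}=\log_2\left(1+\bar\gamma_{\mathrm{D}}|h_{\mathrm{R},\mathrm{D}}|^2\right),$$ $\mathcal{R}_2=\max\{\min\{\mathcal{R}^{2}_{\mathrm{S}\to\mathrm{R}},\mathcal{R}^{2}_{\mathrm{R}\to\mathrm{D}}\},0\}$ and $\mathcal{P}_2=\Pr(\mathcal{R}_2<\mathcal{R})$. Then as $\bar\gamma_{\mathrm{D}}\to\infty$, $$\mathcal{P}_2\approx\mathcal{P}_2^{\lim}+\hat{\mathcal{M}}_2\bar\gamma_{\mathrm{D}}^{-1},$$ in the sense that $\mathcal{P}_2\to\mathcal{P}_2^{\lim}$ and $\bar\gamma_{\mathrm{D}}(\mathcal{P}_2-\mathcal{P}_2^{\lim})\to\hat{\mathcal{M}}_2$,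 where $$\mathcal{P}_2^{\lim}=1-\frac{1}{1+\frac{1}{\beta}2^{\mathcal{R}}},\qquad \hat{\mathcal{M}}_2=\frac{(2^{\mathcal{R}}-1)(1+1/\alpha)}{1+\frac{1}{\beta}2^{\mathcal{R}}}.$$
   Context: $\mathcal{CN}(0,1)$ denotes a circularly symmetric complex Gaussian random variable with zero mean and unit variance (Rayleigh fading). The quantities model a decode-and-forward relay system where the eavesdropper overhears only the source; $\bar\gamma$'s are average SNRs, $\mathcal{R}_2$ the secrecy capacity and $\mathcal{P}_2$ the secrecy outage probability. *)

(* Defs.v *)
From HB Require Import structures.
From mathcomp Require Import all_boot all_order all_algebra.
From mathcomp Require Import all_classical all_reals all_analysis.
Set Implicit Arguments. Unset Strict Implicit. Unset Printing Implicit Defensive.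
Import Order.TTheory GRing.Theory Num.Theory.
Import numFieldNormedType.Exports.
Local Open Scope classical_set_scope.
Local Open Scope ring_scope.

(* Index of the three links: 0 = (S,R), 1 = (R,D), 2 = (S,E).
   A complex channel coefficient h_i is given by its real part X (i,false)
   and imaginary part X (i,true). *)
Definition hSR : 'I_3 := inord 0.
Definition hRD : 'I_3 := inord 1.
Definition hSE : 'I_3 := inord 2.

Section model.
Context {d : measure_display} {T : measurableType d} {R : realType}.

(* Mutual independence of a finite family of real random variables:
   product rule for every choice of Borel sets (taking some sets equal to
   setT yields the product rule for every subfamily). *)
Definition mutually_independent (I : finType) (P : probability T R)
  (X : I -> T -> R) : Prop :=
  (forall i, measurable_fun setT (X i)) /\
  forall A : I -> set R, (forall i, measurable (A i)) ->
    P (\bigcap_(i in setT) (X i @^-1` A i)) =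
    (\prod_(i : I) P (X i @^-1` A i))%E.

Definition has_normal_law (P : probability T R) (m v : R) (Y : T -> R) : Prop :=
  forall A : set R, measurable A ->
    P (Y @^-1` A) = normal_prob m (Num.sqrt v) A.

(* The channel coefficients h_i = X(i,false) + j X(i,true), i : 'I_3, are
   independent CN(0,1): their real and imaginary parts are six mutually
   independent N(0,1/2) real random variables. *)
Definition indep_CN01 (P : probability T R) (X : 'I_3 * bool -> T -> R) : Prop :=
  mutually_independent P X /\
  forall k, has_normal_law P 0 (2^-1) (X k).

Definition hsq (X : 'I_3 * bool -> T -> R) (i : 'I_3) (t : T) : R :=
  X (i, false) t ^+ 2 + X (i, true) t ^+ 2.

Definition log2 (x : R) : R := ln x / ln 2.

Definition R2 (alpha beta gD : R) (X : 'I_3 * bool -> T -> R) (t : T) : R :=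
  let gR := alpha * gD in
  let gE := gR / beta in
  let rSR := log2 ((1 + gR * hsq X hSR t) / (1 + gE * hsq X hSE t)) in
  let rRD := log2 (1 + gD * hsq X hRD t) in
  Num.max (Num.min rSR rRD) 0.

Definition P2 (P : probability T R) (Rth alpha beta gD : R)
  (X : 'I_3 * bool -> T -> R) : R :=
  fine (P [set t | R2 alpha beta gD X t < Rth]).

End model.

Definition P2lim {R : realType} (Rth beta : R) : R :=
  1 - 1 / (1 + beta^-1 * (2 `^ Rth)).

Definition M2hat {R : realType} (Rth alpha beta : R) : R :=
  ((2 `^ Rth - 1) * (1 + alpha^-1)) / (1 + beta^-1 * (2 `^ Rth)).

(* Main.v *)
Require Import Defs.
From HB Require Import structures.
From mathcomp Require Import all_boot all_order all_algebra.
From mathcomp Require Import all_classical all_reals all_analysis.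
From mathcomp Require Import measurable_realfun ring lra.
Import Order.TTheory GRing.Theory Num.Theory.
Import numFieldNormedType.Exports.
Local Open Scope classical_set_scope.
Local Open Scope ring_scope.

(** Writing [b = 2^Rth], the relay link is not in outage exactly when
    [|h_SR|^2 >= s + k |h_SE|^2] and [|h_RD|^2 >= c], where
    [s = (b - 1) / (alpha gD)], [k = b / beta] and [c = (b - 1) / gD].  The
    squared magnitudes are independent unit exponential variables, so this
    event has probability
    [e^-(s + c) E(e^(-k |h_SE|^2)) = e^-(s + c) / (1 + k)].
    Since [s + c] is a constant multiple of [1 / gD], both limits are read off
    this exact formula.

    That [|h|^2] is exponential needs no polar coordinates: by scaling, the
    area of the disk [|z|^2 < r] is proportional to [r], so [z |-> |z|^2] maps
    the Lebesgue measure of the plane to a multiple of that of the half-line,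
    and the Gauss integral shows the factor to be [pi]. *)

Local Notation plane R := (measurableTypeR R * measurableTypeR R)%type.

Lemma measurable_preimage {d1 d2} {T1 : measurableType d1}
    {T2 : measurableType d2} {f : T1 -> T2} {A : set T2} :
  measurable_fun setT f -> measurable A -> measurable (f @^-1` A).
Proof. by move=> mf mA; rewrite -[X in measurable X]setTI; exact: mf. Qed.

Lemma measure_rayNy_unique {R : realType}
    (m1 m2 : {measure set (measurableTypeR R) -> \bar R}) :
  (forall r, m1 `]-oo, r[%classic = m2 `]-oo, r[%classic) ->
  (forall r, m1 `]-oo, r[%classic < +oo)%E ->
  forall A, measurable A -> m1 A = m2 A.
Proof.
move=> m12 m1oo; apply: (@measure_unique _ _ (measurableTypeR R)
  (@RGenInftyO.G R) (fun n => `]-oo, n%:R[%classic)).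
- exact: RGenInftyO.measurableE.
- move=> _ _ [x ->] [y ->]; exists (Num.min x y); apply/seteqP.
  by split=> z /=; rewrite !in_itv/= lt_min => /andP.
- by move=> n; exists n%:R.
- apply/seteqP; split => // x _.
  by exists (Num.truncn x).+1 => //=; rewrite in_itv/= truncnS_gt.
- by move=> _ [r ->].
- by move=> n.
Qed.

Section lebesgue_scaling.
Context {R : realType}.
Local Notation mu := (@lebesgue_measure R).
Local Open Scope ereal_scope.

Lemma lebesgue_measure_scale {c : R} {A : set R} : c != 0%R -> measurable A ->
  mu A = `|c|%:E * mu ( *%R c @^-1` A).
Proof.
move=> c0 mA.
pose m : {measure set (measurableTypeR R) -> \bar R} := mscale
  (NngNum (normr_ge0 c)) (pushforward mu ( *%R c : R -> measurableTypeR R)).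
rewrite (@lebesgue_measure_unique _ (m (mulrl_measurable c)))//=.
move=> _ [[a b]] _ <-; rewrite /m /mscale/= /pushforward.
have [cn|cp|/eqP] := ltgtP c 0%R; last by rewrite (negbTE c0).
- have -> : *%R c @^-1` `]a, b]%classic = `[(b / c)%R, (a / c)%R[%classic.
    apply/seteqP; split => x /=;
      by rewrite !in_itv/= ltr_ndivlMr// ler_ndivrMr// mulrC andbC.
  rewrite !lebesgue_measure_itv/= !lte_fin ltr_nM2r ?invr_lt0//.
  case: ifPn => _; last by rewrite mule0.
  by rewrite -!EFinB -EFinM ltr0_norm//; congr EFin; field.
- have -> : *%R c @^-1` `]a, b]%classic = `](a / c)%R, (b / c)%R]%classic.
    apply/seteqP; split => x /=;
      by rewrite !in_itv/= ltr_pdivrMr// ler_pdivlMr// mulrC.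
  rewrite !lebesgue_measure_itv/= !lte_fin ltr_pM2r ?invr_gt0//.
  case: ifPn => _; last by rewrite mule0.
  by rewrite -!EFinB -EFinM gtr0_norm//; congr EFin; field.
Qed.

Lemma lebesgue_measure2_scale {c : R} {A : set (plane R)} :
  c != 0%R -> measurable A ->
  (mu \x mu) A = (c ^+ 2)%:E * (mu \x mu) [set z | A (c * z.1, c * z.2)%R].
Proof.
move=> c0 mA.
pose scale (z : plane R) : plane R := (c * z.1, c * z.2)%R.
have mscale2 : measurable_fun setT scale.
  by apply: measurable_fun_pair; apply: measurable_funM.
pose m : {measure set (plane R) -> \bar R} :=
  mscale (NngNum (sqr_ge0 c)) (pushforward (mu \x mu) scale).
rewrite (@product_measure_unique _ _ _ _ _ mu mu (m mscale2))// => B D mB mD.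
rewrite /m/= /mscale/= /pushforward.
rewrite [X in (mu \x mu) X](_ : _ = ( *%R c @^-1` B) `*` ( *%R c @^-1` D))//.
rewrite product_measure1E; last 2 first.
- exact: (measurable_preimage (mulrl_measurable c) mB).
- exact: (measurable_preimage (mulrl_measurable c) mD).
rewrite (lebesgue_measure_scale c0 mB) (lebesgue_measure_scale c0 mD).
by rewrite muleACA -EFinM -normrM -expr2 ger0_norm// sqr_ge0.
Qed.

End lebesgue_scaling.

Section sqnorm.
Context {R : realType}.
Local Notation mu := (@lebesgue_measure R).
Local Open Scope ereal_scope.

Definition sqnorm (z : plane R) : measurableTypeR R :=
  (z.1 ^+ 2 + z.2 ^+ 2)%R.

Lemma sqnorm_ge0 z : (0 <= sqnorm z)%R.
Proof. by rewrite addr_ge0 ?sqr_ge0. Qed.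

Lemma measurable_sqnorm : measurable_fun setT sqnorm.
Proof. by apply: measurable_funD; exact: measurable_funX. Qed.

Let disk_area := (mu \x mu) (sqnorm @^-1` `]-oo, 1%R[).

Let disk_area_fin_num : disk_area \is a fin_num.
Proof.
rewrite ge0_fin_numE; last exact: measure_ge0.
apply: (@le_lt_trans _ _ ((mu \x mu) (`](-1)%R, 1%R[ `*` `](-1)%R, 1%R[))).
  apply: le_measure; rewrite ?inE.
  - exact: measurable_preimage measurable_sqnorm _.
  - exact: measurableX.
  - move=> [x y]; rewrite /sqnorm/= !in_itv/= => xy1.
    by split; apply/andP; split; nra.
by rewrite product_measure1E//= !lebesgue_measure_itv/= lte_fin; case: ifP;
  rewrite ?ltry// mule0.
Qed.

Let disk_area_ge0 : (0 <= fine disk_area)%R.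
Proof. by apply: fine_ge0; exact: measure_ge0. Qed.

Let open_disk_area (r : R) :
  (mu \x mu) (sqnorm @^-1` `]-oo, r[) = disk_area * (Num.max r 0%R)%:E.
Proof.
have [r0|r0] := leP r 0%R.
  rewrite mule0 -[RHS](measure0 (mu \x mu)); congr (_ _).
  apply/seteqP; split => // z /=; rewrite in_itv/= => zr.
  by have := lt_le_trans zr r0; rewrite ltNge sqnorm_ge0.
rewrite (@lebesgue_measure2_scale _ (Num.sqrt r)); last 2 first.
- by rewrite gt_eqF// sqrtr_gt0.
- exact: measurable_preimage measurable_sqnorm _.
have sqrtrK : (Num.sqrt r ^+ 2 = r)%R by rewrite sqr_sqrtr// ltW.
rewrite sqrtrK [LHS]muleC; congr (_ * _); rewrite /disk_area.
congr ((mu \x mu) _); apply/seteqP.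
by split => z /=; rewrite !in_itv/= /sqnorm/= !exprMn sqrtrK -mulrDr gtr_pMr.
Qed.

Let area_preimage_sqnorm (A : set (measurableTypeR R)) : measurable A ->
  A `<=` `[0%R, +oo[ -> (mu \x mu) (sqnorm @^-1` A) = disk_area * mu A.
Proof.
move=> mA A0.
have mD : measurable (`[0%R, +oo[%classic : set (measurableTypeR R)) by [].
pose m1 : {measure set (measurableTypeR R) -> \bar R} :=
  pushforward (mu \x mu) sqnorm.
pose m2 : {measure set (measurableTypeR R) -> \bar R} :=
  mscale (NngNum disk_area_ge0) (mrestr mu mD).
have m2E B : m2 B = disk_area * mu (B `&` `[0%R, +oo[).
  by rewrite /m2/= /mscale/= (fineK disk_area_fin_num).
have mray r : mu (`]-oo, r[ `&` `[0%R, +oo[) = (Num.max r 0%R)%:E.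
  rewrite (_ : _ `&` _ = `[0%R, r[%classic); last first.
    by apply/seteqP; split => x /=; rewrite !in_itv/= andbT;
      [move=> [-> ->]|move=> /andP[-> ->]].
  rewrite lebesgue_measure_itv/= lte_fin; case: ltP => // r0.
  by rewrite -EFinB subr0.
have := @measure_rayNy_unique _ (m1 measurable_sqnorm) m2 _ _ A mA.
rewrite m2E (setIidl A0); apply => r.
- by rewrite m2E mray; exact: open_disk_area.
- rewrite [X in X < _]open_disk_area -ge0_fin_numE ?fin_numM//.
  by rewrite mule_ge0// ?measure_ge0// lee_fin le_max lexx orbT.
Qed.

Let ge0_integral_sqnorm_area (f : R -> \bar R) :
  measurable_fun setT f -> (forall x, 0 <= f x) ->
  \int[mu \x mu]_z f (sqnorm z) = disk_area * \int[mu]_(x in `[0%R, +oo[) f x.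
Proof.
move=> mf f0.
have mfD : measurable_fun (`[0%R, +oo[%classic : set (measurableTypeR R)) f.
  exact: measurable_funTS.
transitivity (\int[pushforward (mu \x mu) sqnorm]_(x in `[0%R, +oo[) f x).
  rewrite (ge0_integral_pushforward measurable_sqnorm)//; congr integral.
  by apply/seteqP; split => // z _ /=; rewrite in_itv/= sqnorm_ge0.
transitivity (\int[mscale (NngNum disk_area_ge0) mu]_(x in `[0%R, +oo[) f x).
  apply: eq_measure_integral => [|A mA A0]; first exact: measurable_sqnorm.
  rewrite [RHS]/= /mscale/= (fineK disk_area_fin_num).
  exact: area_preimage_sqnorm.
by rewrite ge0_integral_mscale//= (fineK disk_area_fin_num).
Qed.

Let integral_expRN_sqnorm : \int[mu \x mu]_z (expR (- sqnorm z))%:E = pi%:E.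
Proof.
have mgauss : measurable_fun setT (fun x : R => (gauss_fun x)%:E).
  by apply/measurable_EFinP; exact: measurable_gauss_fun.
rewrite fubini_tonelli1//=; last first.
  apply/measurable_EFinP; apply: measurableT_comp => //.
  by apply: measurableT_comp => //; exact: measurable_sqnorm.
transitivity (\int[mu]_x ((gauss_fun x)%:E * (Num.sqrt pi)%:E)).
  apply: eq_integral => x _; rewrite /fubini_F -integralT_gauss.
  rewrite -ge0_integralZl// => [|y _|]; rewrite ?lee_fin ?gauss_fun_ge0//.
  by apply: eq_integral => y _; rewrite -EFinM -expRD -opprD.
rewrite ge0_integralZr//= => [|x _]; rewrite ?lee_fin ?gauss_fun_ge0//.
by rewrite integralT_gauss -EFinM -expr2 sqr_sqrtr// pi_ge0.
Qed.

Let disk_areaE : disk_area = pi%:E.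
Proof.
rewrite -integral_expRN_sqnorm.
rewrite (ge0_integral_sqnorm_area (fun r => (expR (- r))%:E)); last 2 first.
- by apply/measurable_EFinP; exact: measurableT_comp.
- by move=> x; rewrite lee_fin expR_ge0.
rewrite -[LHS]mule1 -(integral_exponential_pdf (R := R) ltr01).
rewrite [in RHS]integral_mkcond; congr (_ * _); apply: eq_integral => x _.
by rewrite /exponential_pdf !patchE; case: ifP; rewrite // mul1r mulN1r.
Qed.

Lemma ge0_integral_sqnorm (f : R -> \bar R) {A : set (measurableTypeR R)} :
  measurable A -> measurable_fun setT f -> (forall x, 0 <= f x) ->
  \int[mu \x mu]_(z in sqnorm @^-1` A) f (sqnorm z) =
  pi%:E * \int[mu]_(x in `[0%R, +oo[ `&` A) f x.
Proof.
move=> mA mf f0; rewrite integral_mkcondr -disk_areaE.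
rewrite -ge0_integral_sqnorm_area.
- by rewrite [LHS]integral_mkcond; apply: eq_integral => z _; rewrite !patchE.
- by apply: (measurable_restrictT _ mA).1; exact: measurable_funTS.
- by move=> x; exact: erestrict_ge0.
Qed.

End sqnorm.

Lemma ge0_integral_density {d} {T : measurableType d} {R : realType}
    (nu : {finite_measure set T -> \bar R})
    (mu : {sigma_finite_measure set T -> \bar R}) {f g : T -> \bar R} :
  measurable_fun setT f ->
  (forall A, measurable A -> nu A = \int[mu]_(x in A) f x)%E ->
  measurable_fun setT g -> (forall x, 0 <= g x)%E ->
  (\int[nu]_x g x = \int[mu]_x (g x * f x))%E.
Proof.
move=> mf nuE mg g0.
have dom : nu `<< mu.
  apply/null_content_dominatesP => A mA muA0; rewrite nuE//.
  by apply: null_set_integral => //; exact: measurable_funTS.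
rewrite -(Radon_Nikodym_SigmaFinite.change_of_variables dom)//.
have intRN := Radon_Nikodym_SigmaFinite.f_integrable dom.
apply: ae_eq_integral => //; try by apply: emeasurable_funM => //;
  exact: measurable_int intRN.
apply: ae_eqe_mul2l; apply: integral_ae_eq => // E _ mE.
by rewrite -Radon_Nikodym_SigmaFinite.f_integral// nuE.
Qed.

Lemma product_measure_density {d1 d2} {T1 : measurableType d1}
    {T2 : measurableType d2} {R : realType}
    (m1 : {finite_measure set T1 -> \bar R})
    (m2 : {finite_measure set T2 -> \bar R})
    (mu1 : {sigma_finite_measure set T1 -> \bar R})
    (mu2 : {sigma_finite_measure set T2 -> \bar R})
    {f1 : T1 -> \bar R} {f2 : T2 -> \bar R} {S : set (T1 * T2)} :
  measurable_fun setT f1 -> (forall x, 0 <= f1 x)%E ->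
  measurable_fun setT f2 -> (forall y, 0 <= f2 y)%E ->
  (forall A, measurable A -> m1 A = \int[mu1]_(x in A) f1 x)%E ->
  (forall A, measurable A -> m2 A = \int[mu2]_(y in A) f2 y)%E ->
  measurable S ->
  ((m1 \x m2) S = \int[mu1 \x mu2]_(z in S) (f1 z.1 * f2 z.2))%E.
Proof.
move=> mf1 f10 mf2 f20 m1E m2E mS.
have mf : measurable_fun S (fun z => f1 z.1 * f2 z.2)%E.
  by apply: measurable_funTS; apply: emeasurable_funM; exact: measurableT_comp.
rewrite integral_mkcond fubini_tonelli1; last 2 first.
- exact: (measurable_restrictT _ mS).1.
- by move=> z; apply: erestrict_ge0 => ? _; exact: mule_ge0.
rewrite [LHS](ge0_integral_density m1 mu1 mf1 m1E)//; last first.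
  exact: measurable_fun_xsection.
apply: eq_integral => x _; rewrite /fubini_F /=.
rewrite m2E; last exact: measurable_xsection.
rewrite muleC -ge0_integralZl//; last 2 first.
- exact: measurable_xsection.
- exact: measurable_funTS.
rewrite [LHS]integral_mkcond; apply: eq_integral => y _.
by rewrite !patchE mem_xsection.
Qed.

Section normal_sqnorm.
Context {R : realType}.
Local Notation mu := (@lebesgue_measure R).
Local Open Scope ereal_scope.

Lemma normal_pdfM (s x y : R) : s != 0%R ->
  (normal_pdf 0 s x * normal_pdf 0 s y =
   pi^-1 * exponential_pdf (s ^+ 2 *+ 2)^-1 (sqnorm (x, y)))%R.
Proof.
move=> s0; rewrite exponential_pdfE ?sqnorm_ge0// !normal_pdfE//.
rewrite /normal_peak /normal_fun !subr0.
move: (@pi R) (pi_gt0 R) => p p0.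
rewrite mulrACA -expRD -invfM -expr2 sqr_sqrtr; last first.
  by rewrite mulrn_wge0// mulr_ge0 ?sqr_ge0// ltW.
by rewrite /sqnorm/= mulrA; congr (_ * expR _)%R; field; rewrite ?s0 ?gt_eqF.
Qed.

Lemma normal_prob_sqnorm (s : R) (A : set (measurableTypeR R)) :
  s != 0%R -> measurable A ->
  (normal_prob 0 s \x normal_prob 0 s) (sqnorm @^-1` A) =
  exponential_prob (s ^+ 2 *+ 2)^-1 A.
Proof.
move=> s0 mA; set a := (s ^+ 2 *+ 2)^-1%R.
have piV0 : (0 <= pi^-1 :> R)%R by rewrite invr_ge0 pi_ge0.
have pdf0 r : (0 <= exponential_pdf a r)%R.
  by rewrite exponential_pdf_ge0// invr_ge0 mulrn_wge0// sqr_ge0.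
have mnormal : measurable_fun setT (fun x => (normal_pdf 0 s x)%:E).
  by apply/measurable_EFinP; exact: measurable_normal_pdf.
have normal0 x : 0 <= (normal_pdf 0 s x)%:E by rewrite lee_fin normal_pdf_ge0.
rewrite (product_measure_density _ _ mu mu mnormal normal0 mnormal normal0)//;
  last exact: measurable_preimage measurable_sqnorm _.
pose f r := (pi^-1 * exponential_pdf a r)%:E.
have mf : measurable_fun setT f.
  apply/measurable_EFinP; apply: measurable_funM => //.
  exact: measurable_exponential_pdf.
have f0 r : 0 <= f r by rewrite lee_fin mulr_ge0.
transitivity (\int[mu \x mu]_(z in sqnorm @^-1` A) f (sqnorm z)).
  apply: eq_integral => z _.
  by rewrite -EFinM normal_pdfM// -surjective_pairing.
rewrite ge0_integral_sqnorm// -ge0_integralZl//; last 3 first.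
- exact: measurableI.
- exact: measurable_funTS.
- by rewrite lee_fin pi_ge0.
rewrite integral_mkcondl; apply: eq_integral => r _.
rewrite /f /exponential_pdf !patchE; case: (_ \in _) => //.
by rewrite -EFinM mulVKf// gt_eqF// pi_gt0.
Qed.

End normal_sqnorm.

Section exponential.
Context {R : realType}.
Local Notation mu := (@lebesgue_measure R).
Local Open Scope ereal_scope.

Lemma ge0_integral_exponential_prob (a : R) (g : R -> \bar R) :
  (0 < a)%R -> measurable_fun setT g -> (forall x, 0 <= g x) ->
  \int[exponential_prob a]_x g x = \int[mu]_x (g x * (exponential_pdf a x)%:E).
Proof.
move=> a0; pose nu : {finite_measure set (measurableTypeR R) -> \bar R} :=
  exponential_prob a.
apply: (ge0_integral_density (nu a0)) => //.
by apply/measurable_EFinP; exact: measurable_exponential_pdf.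
Qed.

Lemma exponential_prob_itvcy (a s : R) : (0 < a)%R -> (0 <= s)%R ->
  exponential_prob a `[s, +oo[ = (expR (- a * s))%:E.
Proof.
move=> a0 s0.
pose f x := (a * expR (- a * x))%R; pose F x := (- expR (- a * x))%R.
have dF x : is_derive x (1%R : R) F (f x).
  by apply: is_derive_eq; rewrite /f /GRing.scale/=; ring.
have cf : continuous f.
  move=> x; apply/differentiable_continuous/derivable1_diffP; exact: ex_derive.
transitivity (\int[mu]_(x in `[s, +oo[) (f x)%:E).
  apply: eq_integral => x; rewrite inE/= in_itv/= andbT => sx.
  by rewrite exponential_pdfE// (le_trans s0).
rewrite (@ge0_continuous_FTC2y _ f F _ 0%R)//.
- by rewrite sub0e -EFinN /F opprK.
- by move=> x _; rewrite mulr_ge0 ?expR_ge0// ltW.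
- exact: continuous_subspaceT.
- rewrite -oppr0 /F; apply: cvgN; under eq_fun do rewrite mulNr.
  by apply: (cvg_comp _ (fun z => expR (- z)));
    [exact: gt0_cvgMry|exact: cvgr_expR].
- apply: cvg_at_right_filter.
  apply/differentiable_continuous/derivable1_diffP; exact: ex_derive.
- by move=> x _; rewrite derive1E; exact: derive_val.
Qed.

Lemma measurable_expRM (k : R) :
  measurable_fun setT (fun x : R => (expR (k * x))%:E).
Proof.
apply/measurable_EFinP; apply: measurableT_comp => //; exact: measurable_funM.
Qed.

Lemma exponential_prob_laplace (a k : R) : (0 < a)%R -> (0 <= k)%R ->
  \int[exponential_prob a]_x (expR (- k * x))%:E = (a / (a + k))%:E.
Proof.
move=> a0 k0; have ak0 : (0 < a + k)%R by rewrite ltr_pwDl.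
rewrite ge0_integral_exponential_prob//; last exact: measurable_expRM.
rewrite -[RHS]mule1 -(integral_exponential_pdf ak0).
rewrite -ge0_integralZl//=; last 3 first.
- by apply/measurable_EFinP; exact: measurable_exponential_pdf.
- by move=> x _; rewrite lee_fin exponential_pdf_ge0// ltW.
- by rewrite lee_fin divr_ge0// ltW.
apply: eq_integral => x _; rewrite -!EFinM; congr EFin.
rewrite /exponential_pdf !patchE; case: ifP => _; last by rewrite !mulr0.
rewrite mulrCA -expRD mulrA divfK ?gt_eqF//.
by congr (_ * expR _)%R; ring.
Qed.

Lemma measurable_halfplane (s k : R) :
  measurable ([set w | s + k * w.1 <= w.2]%R : set (plane R)).
Proof.
have mf : measurable_fun setT (fun w : plane R => s + k * w.1)%R.
  by apply: measurable_funD => //; exact: measurable_funM.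
have := measurable_fun_ler mf measurable_snd.
by move=> /(_ measurableT [set true] I); rewrite setTI.
Qed.

Lemma exponential_prob_pair_tail (a b k s : R) :
  (0 < a)%R -> (0 < b)%R -> (0 <= k)%R -> (0 <= s)%R ->
  (exponential_prob a \x exponential_prob b) [set w | s + k * w.1 <= w.2]%R =
  (expR (- b * s) * (a / (a + b * k)))%:E.
Proof.
move=> a0 b0 k0 s0.
set W := [set w | _].
have mW : measurable W by exact: measurable_halfplane.
have bk0 : (0 <= b * k)%R by rewrite mulr_ge0// ltW.
have mlaplace := measurable_expRM (- (b * k)).
rewrite EFinM -exponential_prob_laplace// -ge0_integralZl//.
pose mb : {finite_measure set (measurableTypeR R) -> \bar R} :=
  exponential_prob b.
rewrite [LHS]ge0_integral_exponential_prob//; last 2 first.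
- exact: (measurable_fun_xsection (mb b0) mW).
- by move=> x; exact: (measure_ge0 (mb b0)).
rewrite [RHS]ge0_integral_exponential_prob//; last exact: emeasurable_funM.
apply: eq_integral => x _.
have [x0|x0] := ltP x 0%R; first by rewrite lt0_exponential_pdf ?mule0.
congr (_ * _).
rewrite /= (_ : xsection W x = `[(s + k * x)%R, +oo[%classic); last first.
  by apply/seteqP; split => y; rewrite /xsection/= in_itv/= andbT inE.
rewrite exponential_prob_itvcy ?addr_ge0 ?mulr_ge0// -EFinM -expRD.
by congr (expR _)%:E; ring.
Qed.

End exponential.

Section independent_pairs.
Context {d : measure_display} {T : measurableType d} {R : realType}.
Local Open Scope ereal_scope.

Definition has_law (P : probability T R) (m : set (measurableTypeR R) -> \bar R)
  (Y : T -> R) : Prop := forall A, measurable A -> P (Y @^-1` A) = m A.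

Lemma product_measure_joint_law {d1 d2} {T1 : measurableType d1}
    {T2 : measurableType d2} {P : probability T R}
    {m1 : probability T1 R} {m2 : probability T2 R}
    {Y1 : T -> T1} {Y2 : T -> T2} {E : set T} {p : \bar R} :
  measurable_fun setT Y1 -> measurable_fun setT Y2 -> measurable E ->
  (forall A B, measurable A -> measurable B ->
    P (Y1 @^-1` A `&` Y2 @^-1` B `&` E) = m1 A * m2 B * p) ->
  forall C, measurable C ->
    P ((fun t => (Y1 t, Y2 t)) @^-1` C `&` E) = (m1 \x m2) C * p.
Proof.
move=> mY1 mY2 mE rectE C mC.
have pE : p = P E.
  have := rectE setT setT measurableT measurableT.
  by rewrite !preimage_setT !setTI !probability_setT !mul1e.
rewrite {}pE in rectE *.
have mY : measurable_fun setT (fun t => (Y1 t, Y2 t)).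
  exact: measurable_fun_pair.
have PE0 : (0 <= fine (P E))%R by exact: fine_ge0.
have PEE : (fine (P E))%:E = P E by rewrite fineK// fin_num_measure.
pose m : {measure set (T1 * T2) -> \bar R} :=
  pushforward (mrestr P mE) (fun t => (Y1 t, Y2 t)).
pose m2E := mscale (NngNum PE0) m2.
transitivity ((m1 \x m2E) C).
  rewrite (@product_measure_unique _ _ _ _ _ m1 m2E (m mY))// => A B mA mB.
  by rewrite /m2E/= /mscale/= PEE /pushforward /mrestr muleCA muleC -rectE.
rewrite /product_measure1 /= /m2E /mscale/= PEE ge0_integralZl//.
- by rewrite muleC.
- exact: measurable_fun_xsection.
Qed.

Definition pair_rv {J : Type} (X : J * bool -> T -> R) (j : J) (t : T) :
  plane R := (X (j, false) t, X (j, true) t).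

Context {J : finType} {P : probability T R} {X : J * bool -> T -> R}
  (m : J * bool -> probability (measurableTypeR R) R).
Hypotheses (indepX : mutually_independent P X)
  (lawX : forall k, has_law P (m k) (X k)).

Let pair_law (j : J) := m (j, false) \x m (j, true).

Let mpair_rv j : measurable_fun setT (pair_rv X j).
Proof.
by apply: (@measurable_fun_pair _ _ _ _
  (measurableTypeR R) (measurableTypeR R)); exact: indepX.1.
Qed.

Let rectangle (C : set (plane R)) :=
  exists AB, [/\ measurable AB.1, measurable AB.2 & C = AB.1 `*` AB.2].

Let prob_bigcap_rectangles (C : J -> set _) : (forall j, rectangle (C j)) ->
  P (\bigcap_(j in setT) (pair_rv X j @^-1` C j)) =
  \prod_(j : J) pair_law j (C j).
Proof.
move=> /choice[AB ABC].
pose F (k : J * bool) := if k.2 then (AB k.1).2 else (AB k.1).1.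
have mF k : measurable (F k) by rewrite /F; case: (ABC k.1) => *; case: ifP.
transitivity (P (\bigcap_(k in setT) (X k @^-1` F k))).
  congr (P _); apply/seteqP; split => t Ct.
    by move=> [j b] _; have := Ct j I; case: (ABC j) => _ _ -> [/=]; case: b.
  move=> j _; case: (ABC j) => _ _ /= ->.
  by split; [exact: (Ct (j, false) I)|exact: (Ct (j, true) I)].
rewrite indepX.2//.
rewrite (eq_bigr (fun k => m (k.1, k.2) (F (k.1, k.2)))); last first.
  by move=> [j b] _; exact: (lawX (j, b) _ (mF _)).
rewrite -(pair_bigA _ (fun j b => m (j, b) (F (j, b))))/=.
apply: eq_bigr => j _; rewrite big_bool /= muleC /F /=.
by case: (ABC j) => mA mB ->; rewrite /pair_law product_measure1E.
Qed.

(* Induction on the list [r] of indices whose set is not assumed to be a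
   rectangle. *)
Let prob_bigcap_pairs_seq (r : seq J) (C : J -> set _) :
  (forall j, measurable (C j)) -> (forall j, j \notin r -> rectangle (C j)) ->
  P (\bigcap_(j in setT) (pair_rv X j @^-1` C j)) =
  \prod_(j : J) pair_law j (C j).
Proof.
elim: r C => [|i r IHr] C mC rectC.
  by apply: prob_bigcap_rectangles => j; exact: rectC.
pose others := \bigcap_(j in ~` [set i]) (pair_rv X j @^-1` C j).
have mothers : measurable others.
  apply: fin_bigcap_measurable => [|j _]; first exact: finite_finset.
  exact: measurable_preimage (mpair_rv j) _.
have split_at D : P (pair_rv X i @^-1` D `&` others) =
    P (\bigcap_(j in setT) (pair_rv X j @^-1` (if j == i then D else C j))).
  rewrite (bigcap_setD1 i)// eqxx setTD; congr (P (_ `&` _)).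
  by apply: eq_bigcapr => j /eqP /negbTE ->.
have rect_at A B : measurable A -> measurable B ->
    P (X (i, false) @^-1` A `&` X (i, true) @^-1` B `&` others) =
    m (i, false) A * m (i, true) B *
    \prod_(j | j != i) pair_law j (C j).
  move=> mA mB; rewrite [LHS](split_at (A `*` B)) IHr.
  - rewrite (bigD1 i)//= eqxx /pair_law product_measure1E//; congr (_ * _).
    by apply: eq_bigr => j /negbTE ->.
  - by move=> j; case: ifP => // _; exact: measurableX.
  - move=> j jr; have [_|ji] := eqVneq j i; first by exists (A, B).
    by apply: rectC; rewrite inE negb_or ji.
transitivity (P (pair_rv X i @^-1` C i `&` others)).
  rewrite [RHS](split_at (C i)); congr (P _); apply: eq_bigcapr => j _.
  by case: eqP => [->|].
rewrite (bigD1 i)//=; apply: (@product_measure_joint_law _ _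
  (measurableTypeR R) (measurableTypeR R)) => //; exact: indepX.1.
Qed.

Lemma prob_bigcap_pairs (C : J -> set (plane R)) :
  (forall j, measurable (C j)) ->
  P (\bigcap_(j in setT) (pair_rv X j @^-1` C j)) =
  \prod_(j : J) (m (j, false) \x m (j, true)) (C j).
Proof.
by move=> mC; apply: (prob_bigcap_pairs_seq (enum J)) => // j; rewrite mem_enum.
Qed.

Lemma prob_pair (j : J) (C : set (plane R)) :
  measurable C -> P (pair_rv X j @^-1` C) = (m (j, false) \x m (j, true)) C.
Proof.
move=> mC; pose D i := if i == j then C else setT.
have mD i : measurable (D i) by rewrite /D; case: ifP.
transitivity (P (\bigcap_(i in setT) (pair_rv X i @^-1` D i))).
  congr (P _); apply/seteqP; split => t Ct.
    by move=> i _; rewrite /D; case: eqP => [->|].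
  by have := Ct j I; rewrite /D eqxx.
rewrite prob_bigcap_pairs// (bigD1 j)//= {1}/D eqxx.
rewrite big1 ?mule1// => i /negbTE ij.
by rewrite /D ij; exact: probability_setT.
Qed.

Lemma mutually_independent_pairs (phi : J -> plane R -> R) :
  (forall j, measurable_fun setT (phi j)) ->
  mutually_independent P (fun j t => phi j (pair_rv X j t)).
Proof.
move=> mphi; have mpre j A : measurable A -> measurable (phi j @^-1` A).
  exact: measurable_preimage.
split=> [j|A mA]; first exact: measurableT_comp (mphi j) (mpair_rv j).
rewrite -[LHS]/(P (\bigcap_(j in setT) (pair_rv X j @^-1` (phi j @^-1` A j)))).
rewrite prob_bigcap_pairs; last by move=> j; exact: mpre.
by apply: eq_bigr => j _; rewrite -prob_pair//; exact: mpre.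
Qed.

End independent_pairs.

Section subfamilies.
Context {d : measure_display} {T : measurableType d} {R : realType}.
Context {J : finType} {P : probability T R} {Y : J -> T -> R}.
Hypothesis indepY : mutually_independent P Y.
Local Open Scope ereal_scope.

Lemma mutually_independent_subfamily (s : seq J) (A : J -> set R) :
  uniq s -> (forall i, measurable (A i)) ->
  P (\bigcap_(i in [set` s]) (Y i @^-1` A i)) =
  \prod_(i <- s) P (Y i @^-1` A i).
Proof.
move=> s_uniq mA; pose F i := if i \in s then A i else setT.
have mF i : measurable (F i) by rewrite /F; case: ifP.
transitivity (P (\bigcap_(i in setT) (Y i @^-1` F i))).
  congr (P _); apply/seteqP; split => t At i.
    by move=> _; rewrite /F; case: ifPn => // /At.
  by move=> /= si; have := At i I; rewrite /F si.
rewrite indepY.2// [in RHS]big_uniq//= [RHS]big_mkcond; apply: eq_bigr => i _.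
by rewrite /F; case: ifP => // _; exact: probability_setT.
Qed.

Lemma prob_joint_law_setI {m1 m2 : probability (measurableTypeR R) R}
    {i j l : J} {C : set (plane R)} {B : set R} :
  uniq [:: i; j; l] -> has_law P m1 (Y i) -> has_law P m2 (Y j) ->
  measurable C -> measurable B ->
  P ((fun t => (Y i t, Y j t)) @^-1` C `&` Y l @^-1` B) =
  (m1 \x m2) C * P (Y l @^-1` B).
Proof.
move=> ijl lawi lawj mC mB.
apply: (@product_measure_joint_law _ _ _ _ _
  (measurableTypeR R) (measurableTypeR R)) => //.
- exact: indepY.1.
- exact: indepY.1.
- exact: measurable_preimage (indepY.1 l) mB.
move=> D E mD mE; rewrite -(lawi _ mD) -(lawj _ mE).
pose F k := if k == i then D else if k == j then E else B.
have mF k : measurable (F k) by rewrite /F; do 2 case: ifP => // _.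
have := mutually_independent_subfamily _ F ijl mF.
rewrite bigcap_seq !big_cons !big_nil setIT mule1 setIA muleA /F !eqxx.
move: ijl => /=; rewrite !inE negb_or andbT ![j == _]eq_sym ![l == _]eq_sym.
by move=> /andP[/andP[/negbTE -> /negbTE ->] /negbTE ->].
Qed.

End subfamilies.

Lemma cvg_invr_pinfty {R : realType} : g^-1 @[g --> +oo] --> (0 : R).
Proof.
apply/gtr0_cvgV0; last exact: cvg_id.
by near=> g; near: g; exact: nbhs_pinfty_gt.
Unshelve. all: by end_near.
Qed.

Lemma cvg_expRN_divr {R : realType} (c : R) :
  expR (- (c / g)) @[g --> +oo] --> (1 : R).
Proof.
rewrite -expR0 -oppr0 -(mulr0 c).
apply: (cvg_comp _ expR); last exact: continuous_expR.
by apply: cvgN; apply: cvgM; [exact: cvg_cst|exact: cvg_invr_pinfty].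
Qed.

(* The derivative of [h |-> - expR (- (c * h))] at [0], along [h = g^-1]. *)
Lemma cvg_mulr_subr1_expRN_divr {R : realType} (c : R) :
  g * (1 - expR (- (c / g))) @[g --> +oo] --> c.
Proof.
pose F h := - expR (- (c * h)).
have dF : is_derive (0 : R) 1 F c.
  apply: is_derive_eq; rewrite mulr0 oppr0 expR0 /GRing.scale/=; ring.
have [cvgF derF] := dF.
have Vy_dnbhs0 : (g^-1 : R) @[g --> +oo] --> 0^'.
  move=> A /cvg_invr_pinfty A0.
  suff : \forall g \near +oo, A g^-1 by []; near=> g.
  have g0 : 0 < g by near: g; exact: nbhs_pinfty_gt.
  have : g^-1 != 0 by rewrite gt_eqF ?invr_gt0.
  by near: g.
have cvg_quotient : h^-1 *: (F (h *: 1 + 0) - F 0) @[h --> 0^'] --> c.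
  by rewrite -derF; exact: cvgF.
have := cvg_comp _ _ Vy_dnbhs0 cvg_quotient.
apply: cvg_trans; apply: near_eq_cvg; near=> g.
by rewrite /F /= invrK /GRing.scale/= mulr1 addr0 mulr0 oppr0 expR0 opprK addrC.
Unshelve. all: by end_near.
Qed.

Lemma le_log2 {R : realType} (a y : R) : 0 < y -> (a <= log2 y) = (2 `^ a <= y).
Proof.
move=> y0; rewrite /log2 ler_pdivlMr; last by rewrite ln_gt0// ltr1n.
by rewrite -ler_expR lnK// /powR pnatr_eq0.
Qed.

Section relay.
Context {d : measure_display} {T : measurableType d} {R : realType}.
Context (P : probability T R) (X : 'I_3 * bool -> T -> R).

Lemma hsq_ge0 i t : 0 <= hsq X i t.
Proof. exact: sqnorm_ge0 (pair_rv X i t). Qed.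

Definition no_outage (s k c : R) : set T :=
  [set t | s + k * hsq X hSE t <= hsq X hSR t /\ c <= hsq X hRD t].

Lemma outageE (Rth alpha beta gD : R) :
  0 < Rth -> 0 < alpha -> 0 < beta -> 0 < gD ->
  [set t | R2 alpha beta gD X t < Rth] =
  ~` no_outage ((2 `^ Rth - 1) / (alpha * gD)) (beta^-1 * 2 `^ Rth)
       ((2 `^ Rth - 1) / gD).
Proof.
move=> Rth0 alpha0 beta0 gD0; set b := 2 `^ Rth.
rewrite -[LHS]setCK; congr (~` _); apply/seteqP.
suff rateE t : (Rth <= R2 alpha beta gD X t) =
    ((b - 1) / (alpha * gD) + beta^-1 * b * hsq X hSE t <= hsq X hSR t) &&
    ((b - 1) / gD <= hsq X hRD t).
  by split => t /=; rewrite (rwP negP) -leNgt rateE => /andP.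
have snr_gt0 g i : 0 <= g -> 0 < 1 + g * hsq X i t.
  by move=> g0; rewrite ltr_pwDl// mulr_ge0// hsq_ge0.
have gR0 : 0 < alpha * gD by rewrite mulr_gt0.
have snrSR := snr_gt0 _ hSR (ltW gR0).
have snrRD := snr_gt0 _ hRD (ltW gD0).
have snrSE := snr_gt0 _ hSE (ltW (divr_gt0 gR0 beta0)).
rewrite /R2 le_max [Rth <= 0]leNgt Rth0 orbF le_min.
rewrite !le_log2 ?divr_gt0// -/b ler_pdivlMr//; congr andb.
- rewrite -[RHS](ler_pM2l gR0) -[RHS](lerD2l 1).
  by congr (_ <= _); field; rewrite !gt_eqF.
- by rewrite ler_pdivrMr// lerBlDl mulrC.
Qed.

Lemma no_outageE (s k c : R) : no_outage s k c =
  (fun t => (hsq X hSE t, hsq X hSR t)) @^-1` [set w | s + k * w.1 <= w.2] `&`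
  hsq X hRD @^-1` `[c, +oo[.
Proof. by apply/seteqP; split => t /=; rewrite in_itv/= andbT. Qed.

Hypothesis indepX : indep_CN01 P X.

Lemma hsq_mutually_independent : mutually_independent P (hsq X).
Proof.
have [indep law] := indepX.
exact: (mutually_independent_pairs (fun=> normal_prob 0 (Num.sqrt 2^-1))
  indep law (fun=> sqnorm) (fun=> measurable_sqnorm)).
Qed.

Lemma hsq_exponential i : has_law P (exponential_prob 1) (hsq X i).
Proof.
have [indep law] := indepX => A mA.
have s0 : Num.sqrt 2^-1 != 0 :> R by rewrite gt_eqF// sqrtr_gt0 invr_gt0.
have -> : (1 : R) = ((Num.sqrt 2^-1) ^+ 2 *+ 2)^-1.
  by rewrite sqr_sqrtr ?invr_ge0//; field.
rewrite -normal_prob_sqnorm//.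
apply: (prob_pair (fun=> normal_prob 0 (Num.sqrt 2^-1)) indep law).
exact: measurable_preimage measurable_sqnorm _.
Qed.

Lemma measurable_no_outage (s k c : R) : measurable (no_outage s k c).
Proof.
have mhsq i : measurable_fun setT (hsq X i) := hsq_mutually_independent.1 i.
rewrite no_outageE; apply: measurableI; apply: measurable_preimage => //.
- exact: measurable_fun_pair.
- exact: measurable_halfplane.
Qed.

Lemma prob_no_outage (s k c : R) : 0 <= s -> 0 <= k -> 0 <= c ->
  P (no_outage s k c) = (expR (- (s + c)) / (1 + k))%:E.
Proof.
move=> s0 k0 c0.
pose expo : probability (measurableTypeR R) R := exponential_prob 1.
have law i : has_law P (expo ltr01) (hsq X i) by exact: hsq_exponential.
have links : uniq [:: hSE; hSR; hRD] by rewrite /= !inE -!val_eqE/= !inordK.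
rewrite no_outageE (prob_joint_law_setI hsq_mutually_independent links
  (law _) (law _))//; last exact: measurable_halfplane.
rewrite law// [X in (X * _)%E]exponential_prob_pair_tail//.
rewrite [X in (_ * X)%E]exponential_prob_itvcy// -EFinM; congr EFin.
by rewrite mulrAC div1r !mul1r !mulN1r -expRD opprD.
Qed.

Lemma P2E (Rth alpha beta gD : R) :
  0 < Rth -> 0 < alpha -> 0 < beta -> 0 < gD ->
  P2 P Rth alpha beta gD X =
  1 - expR (- ((2 `^ Rth - 1) * (1 + alpha^-1) / gD)) /
      (1 + beta^-1 * 2 `^ Rth).
Proof.
move=> Rth0 alpha0 beta0 gD0.
have b1 : 0 <= 2 `^ Rth - 1.
  by rewrite subr_ge0 -[leLHS](powRr0 2) ler_powR ?ler1n// ltW.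
rewrite /P2 outageE// probability_setC; last exact: measurable_no_outage.
rewrite prob_no_outage; last 3 first.
- by rewrite divr_ge0// mulr_ge0// ltW.
- by rewrite mulr_ge0 ?invr_ge0 ?powR_ge0// ltW.
- by rewrite divr_ge0// ltW.
rewrite -EFinB/=; congr (1 - expR (- _) / _).
by field; rewrite !gt_eqF.
Qed.

End relay.

Theorem theorem6 (R : realType) (d : measure_display) (T : measurableType d)
  (P : probability T R) (X : 'I_3 * bool -> T -> R)
  (Rth alpha beta : R) :
  0 < Rth -> 0 < alpha -> 0 < beta ->
  indep_CN01 P X ->
  (P2 P Rth alpha beta gD X @[gD --> +oo] --> P2lim Rth beta) /\
  (gD * (P2 P Rth alpha beta gD X - P2lim Rth beta) @[gD --> +oo]
     --> M2hat Rth alpha beta).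
Proof.
move=> Rth0 alpha0 beta0 indepX; rewrite /P2lim /M2hat.
have := P2E P X indepX Rth alpha beta _ Rth0 alpha0 beta0.
set c := (2 `^ Rth - 1) * _; set K := 1 + beta^-1 * _ => P2exact.
split.
- have : 1 - expR (- (c / gD)) / K @[gD --> +oo] --> 1 - 1 / K.
    apply: cvgB; first exact: cvg_cst.
    by apply: cvgM; [exact: cvg_expRN_divr|exact: cvg_cst].
  by apply: cvg_trans; apply: near_eq_cvg; near=> gD; rewrite P2exact.
- have : gD * (1 - expR (- (c / gD))) / K @[gD --> +oo] --> c / K.
    by apply: cvgM; [exact: cvg_mulr_subr1_expRN_divr|exact: cvg_cst].
  by apply: cvg_trans; apply: near_eq_cvg; near=> gD; rewrite P2exact//; ring.
Unshelve. all: by end_near.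
Qed.
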